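(* Both the satisfiability problem and the finite satisfiability problem for the two-variable fluted fragment with equality are undecidable in the presence of two transitive relations.
   Context: Signatures are purely relational. Fix variables $x_1,x_2,\ldots$; $\mathcal{FL}^{[m]}$ is defined by: every atom with argument list exactly $x_\ell,\ldots,x_m$ (contiguous, in order; possibly empty) is in $\mathcal{FL}^{[m]}$; $\mathcal{FL}^{[m]}$ is closed under Boolean combinations; if $\psi\in\mathcal{FL}^{[m+1]}$ then $\exists x_{m+1}\psi,\forall x_{m+1}\psi\in\mathcal{FL}^{[m]}$. The two-variable fluted fragment $\mathcal{FL}^2$ consists of the formulas of $\bigcup_m\mathcal{FL}^{[m]}$ using at most two variables; ''with equality'' means the equality predicate may additionally be used as a binary atom. ''In the presence of two transitive relations'' means the signature contains two distinguished binary predicates required to be interpreted as transitive relations. *)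

(* Defs.v *)
From mathcomp Require Import all_boot.
From Stdlib Require Relation_Definitions List Cantor.

Set Implicit Arguments.
Unset Strict Implicit.
Unset Printing Implicit Defensive.

(* First-order formulas with equality over a purely relational signature.
   The variable x_i is the number i, with i >= 1 in fluted formulas.
   Predicate symbols are pairs (index, arity): [Atom p xs] applies the symbol
   of index [p] and arity [size xs]. *)
Inductive formula : Type :=
  | Atom (p : nat) (xs : seq nat)
  | Equal (x y : nat)
  | Not (phi : formula)
  | And (phi psi : formula)
  | Or (phi psi : formula)
  | Imp (phi psi : formula)
  | Ex (x : nat) (phi : formula)
  | All (x : nat) (phi : formula).

(* All variables, free or bound, including those of vacuous quantifiers. *)
Fixpoint vars (phi : formula) : seq nat :=
  match phi with
  | Atom _ xs => xs
  | Equal x y => [:: x; y]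
  | Not phi => vars phi
  | And phi psi | Or phi psi | Imp phi psi => vars phi ++ vars psi
  | Ex x phi | All x phi => x :: vars phi
  end.

(* [fluted m] is FL^[m] with equality; [index_iota l m.+1] is x_l, ..., x_m,
   the empty list when l = m + 1. *)
Inductive fluted : nat -> formula -> Prop :=
  | fluted_atom m l p :
      0 < l <= m.+1 -> fluted m (Atom p (index_iota l m.+1))
  | fluted_equal l : 0 < l -> fluted l.+1 (Equal l l.+1)
  | fluted_not m phi : fluted m phi -> fluted m (Not phi)
  | fluted_and m phi psi :
      fluted m phi -> fluted m psi -> fluted m (And phi psi)
  | fluted_or m phi psi :
      fluted m phi -> fluted m psi -> fluted m (Or phi psi)
  | fluted_imp m phi psi :
      fluted m phi -> fluted m psi -> fluted m (Imp phi psi)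
  | fluted_ex m phi : fluted m.+1 phi -> fluted m (Ex m.+1 phi)
  | fluted_all m phi : fluted m.+1 phi -> fluted m (All m.+1 phi).

Definition FL2 (phi : formula) : Prop :=
  (exists m, fluted m phi) /\ size (undup (vars phi)) <= 2.

(* The k-ary symbol of index p is interpreted by the restriction of [interp p]
   to the lists of length k. *)
Record structure : Type := Structure {
  domain :> Type;
  domain_inhabited : inhabited domain;
  interp : nat -> seq domain -> Prop
}.

Definition update (D : Type) (v : nat -> D) (x : nat) (d : D) : nat -> D :=
  fun y => if y == x then d else v y.

Fixpoint holds (M : structure) (v : nat -> M) (phi : formula) : Prop :=
  match phi with
  | Atom p xs => interp p (map v xs)
  | Equal x y => v x = v y
  | Not phi => ~ holds v phi
  | And phi psi => holds v phi /\ holds v psi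
  | Or phi psi => holds v phi \/ holds v psi
  | Imp phi psi => holds v phi -> holds v psi
  | Ex x phi => exists d : M, holds (update v x d) phi
  | All x phi => forall d : M, holds (update v x d) phi
  end.

(* The two distinguished predicates are the binary symbols of index 0 and 1. *)
Definition two_transitive (M : structure) : Prop :=
  Relation_Definitions.transitive M (fun a b => interp 0 [:: a; b]) /\
  Relation_Definitions.transitive M (fun a b => interp 1 [:: a; b]).

Definition finite (M : structure) : Prop :=
  exists s : seq M, forall a : M, List.In a s.

Definition satisfiable (phi : formula) : Prop :=
  exists (M : structure) (v : nat -> M), two_transitive M /\ holds v phi.

Definition finitely_satisfiable (phi : formula) : Prop :=
  exists (M : structure) (v : nat -> M),
    [/\ finite M, two_transitive M & holds v phi].

(* Partial recursive functions on nat, by arity. *)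
Inductive recfun : nat -> Type :=
  | Zero : recfun 0
  | Succ : recfun 1
  | Proj n (i : 'I_n) : recfun n
  | Comp m n (f : recfun m) (g : 'I_m -> recfun n) : recfun n
  | PrimRec n (f : recfun n) (g : recfun n.+2) : recfun n.+1
  | Mu n (f : recfun n.+1) : recfun n.

(* [computes f t y]: f is defined at t, with value y.  In the [PrimRec] case
   [s i] is the value at (i, behead t). *)
Fixpoint computes (n : nat) (f : recfun n) : n.-tuple nat -> nat -> Prop :=
  match f in recfun n return n.-tuple nat -> nat -> Prop with
  | Zero => fun _ y => y = 0
  | Succ => fun t y => y = (thead t).+1
  | Proj _ i => fun t y => y = tnth t i
  | Comp m _ f g => fun t y =>
      exists u : m.-tuple nat,
        (forall i, computes (g i) t (tnth u i)) /\ computes f u y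
  | PrimRec _ f g => fun t y =>
      exists s : nat -> nat,
        [/\ computes f (behead_tuple t) (s 0),
            forall i, i < thead t ->
              computes g [tuple of i :: s i :: behead_tuple t] (s i.+1)
          & y = s (thead t)]
  | Mu _ f => fun t y =>
      computes f [tuple of y :: t] 0 /\
      forall z, z < y -> exists w, computes f [tuple of z :: t] w.+1
  end.

Definition code_seq (xs : seq nat) : nat :=
  foldr (fun x c => (Cantor.to_nat (x, c)).+1) 0 xs.

Fixpoint code (phi : formula) : nat :=
  match phi with
  | Atom p xs => Cantor.to_nat (0, Cantor.to_nat (p, code_seq xs))
  | Equal x y => Cantor.to_nat (1, Cantor.to_nat (x, y))
  | Not phi => Cantor.to_nat (2, code phi)
  | And phi psi => Cantor.to_nat (3, Cantor.to_nat (code phi, code psi))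
  | Or phi psi => Cantor.to_nat (4, Cantor.to_nat (code phi, code psi))
  | Imp phi psi => Cantor.to_nat (5, Cantor.to_nat (code phi, code psi))
  | Ex x phi => Cantor.to_nat (6, Cantor.to_nat (x, code phi))
  | All x phi => Cantor.to_nat (7, Cantor.to_nat (x, code phi))
  end.

Local Arguments Cantor.to_nat : simpl never.

Lemma code_seq_inj : injective code_seq.
Proof.
elim=> [|x s IH] [|y t] //= /succn_inj e.
by case: (Cantor.to_nat_inj _ _ e) => -> /IH ->.
Qed.

Lemma code_inj : injective code.
Proof.
elim=> [p xs|x y|f IH|f IHf g IHg|f IHf g IHg|f IHf g IHg|x f IH|x f IH]
  [q ys|x' y'|f'|f' g'|f' g'|f' g'|x' f'|x' f'] /= e;
  case: (Cantor.to_nat_inj _ _ e) => //.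
- by move=> {}e; case: (Cantor.to_nat_inj _ _ e) => -> /code_seq_inj ->.
- by move=> {}e; case: (Cantor.to_nat_inj _ _ e) => -> ->.
- by move=> /IH ->.
- by move=> {}e; case: (Cantor.to_nat_inj _ _ e) => /IHf -> /IHg ->.
- by move=> {}e; case: (Cantor.to_nat_inj _ _ e) => /IHf -> /IHg ->.
- by move=> {}e; case: (Cantor.to_nat_inj _ _ e) => /IHf -> /IHg ->.
- by move=> {}e; case: (Cantor.to_nat_inj _ _ e) => -> /IH ->.
- by move=> {}e; case: (Cantor.to_nat_inj _ _ e) => -> /IH ->.
Qed.

(* The problem "given phi in [L], does [P phi] hold?"; nothing is required of
   the algorithm on inputs that do not encode an element of [L]. *)
Definition decidable_problem (L P : formula -> Prop) : Prop :=
  exists f : recfun 1, forall phi : formula, L phi ->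
    exists b : bool, computes f [tuple code phi] b /\ (P phi <-> b).

(* Main.v *)
From HB Require Import structures.
Require Import Defs.
From mathcomp Require Import all_boot.
From mathcomp Require Import zify.
From Stdlib Require Cantor List.
From Stdlib Require Import ClassicalEpsilon FunctionalExtensionality.
From Stdlib Require Import PropExtensionality.

(* To a program c and an input n we attach a sentence such that a run of c on n
   with output 0 yields a finite model, while a run with output 1 excludes all
   models.  If D decides (finite) satisfiability, let c be a program which on
   input n computes D on the sentence "the formula with code n, and the input
   is n", and let n be the code of the part of the sentence describing c; then
   c on input n contradicts the answer of D.  This settles both problems at
   once.

   The models are grids whose rows are the successive configurations of c, each
   register being written in unary along the row.  Two consecutive points of a
   row are linked both ways by the first or the second transitive relation,
   alternately, each point creating its right neighbour; the way back comes
   from equality, since a point related to a point of its own kind is that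
   point.  A vertical edge in one column is composed with the links to give, by
   transitivity, the vertical edge in the next column, in the same relation,
   and is then copied to the other relation.  Only in the leftmost column does
   a point have to create the point above it. *)

Set Implicit Arguments.
Unset Strict Implicit.
Unset Printing Implicit Defensive.

Local Arguments Cantor.to_nat : simpl never.

(** * Computable functions *)

Local Notation pair_code x y := (Cantor.to_nat (x, y)).

(** The witness lives in [Type], so that those of a family can be gathered without choice into the
    function argument of [Comp]. *)
Definition computable n (F : n.-tuple nat -> nat) : Type :=
  {f : recfun n | forall t, computes f t (F t)}.

Lemma computable_ext n (F G : n.-tuple nat -> nat) :
  F =1 G -> computable F -> computable G.
Proof. by move=> FG [f fP]; exists f => t; rewrite -FG. Qed.

Lemma computable_comp m n (F : m.-tuple nat -> nat)
    (G : 'I_m -> n.-tuple nat -> nat) :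
  computable F -> (forall i, computable (G i)) ->
  computable (fun t => F [tuple G i t | i < m]).
Proof.
move=> [f fP] GP; exists (Comp f (fun i => sval (GP i))) => t /=.
exists [tuple G i t | i < m]; split=> [i|]; last exact: fP.
by rewrite tnth_mktuple; case: (GP i).
Qed.

Lemma computable_proj n (i : 'I_n) : computable (fun t : n.-tuple nat => tnth t i).
Proof. by exists (Proj i). Qed.

Lemma computable_succ n (F : n.-tuple nat -> nat) :
  computable F -> computable (fun t => (F t).+1).
Proof.
move=> FP; have S1 : computable (fun t : 1.-tuple nat => (thead t).+1) by exists Succ.
by apply: computable_ext (computable_comp S1 (fun=> FP)) => t; rewrite /thead tnth_mktuple.
Qed.

Lemma computable_const n c : computable (fun _ : n.-tuple nat => c).
Proof.
elim: c => [|c IH]; last exact: computable_succ.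
have Z : computable (fun _ : 0.-tuple nat => 0) by exists Zero.
by apply: (computable_comp Z (G := fun _ _ => 0)) => -[].
Qed.

Lemma computable_primrec (F : nat -> nat) (G : 2.-tuple nat -> nat) :
  computable G ->
  (forall i, F i.+1 = G [tuple i; F i]) ->
  computable (fun t : 1.-tuple nat => F (thead t)).
Proof.
move=> [g gP] FS.
have [f fP] := computable_const 0 (F 0).
exists (PrimRec f g) => t /=; exists F; split=> // i _.
rewrite FS; suff -> : [tuple of [:: i, F i & behead_tuple t]] = [tuple i; F i] by [].
by apply: val_inj; case: t => -[|x [|]].
Qed.

Lemma computable_primrec2 (F : nat -> nat -> nat) (B : 1.-tuple nat -> nat)
    (G : 3.-tuple nat -> nat) :
  computable B -> computable G ->
  (forall y, F 0 y = B [tuple y]) ->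
  (forall i y, F i.+1 y = G [tuple i; F i y; y]) ->
  computable (fun t : 2.-tuple nat => F (tnth t ord0) (tnth t ord_max)).
Proof.
move=> [f fP] [g gP] F0 FS; exists (PrimRec f g) => t /=.
exists (F ^~ (tnth t ord_max)).
have Et : behead_tuple t = [tuple tnth t ord_max].
  by apply: val_inj; case: t => -[|x [|y [|]]].
split=> // [|i _]; first by move: (fP [tuple tnth t ord_max]); rewrite F0 -Et.
rewrite FS; suff -> : [tuple of [:: i, F i (tnth t ord_max) & behead_tuple t]]
  = [tuple i; F i (tnth t ord_max); tnth t ord_max] by [].
by apply: val_inj; rewrite /= -[behead t]/(val (behead_tuple t)) Et.
Qed.

Lemma computable_app1 n (F : nat -> nat) (G : n.-tuple nat -> nat) :
  computable (fun t : 1.-tuple nat => F (thead t)) -> computable G ->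
  computable (fun t => F (G t)).
Proof.
move=> FP GP.
by apply: computable_ext (computable_comp FP (fun=> GP)) => t; rewrite /thead tnth_mktuple.
Qed.

Lemma computable_app2 n (F : nat -> nat -> nat) (G H : n.-tuple nat -> nat) :
  computable (fun t : 2.-tuple nat => F (tnth t ord0) (tnth t ord_max)) ->
  computable G -> computable H ->
  computable (fun t => F (G t) (H t)).
Proof.
move=> FP GP HP.
have GHP (i : 'I_2) : computable (fun t => if i == ord0 then G t else H t).
  by case: (i == ord0).
by apply: computable_ext (computable_comp FP GHP) => t; rewrite !tnth_mktuple.
Qed.

Lemma computable_add n (F G : n.-tuple nat -> nat) :
  computable F -> computable G -> computable (fun t => F t + G t).
Proof.
apply: (@computable_app2 _ addn).
apply: (@computable_primrec2 _ (fun t => thead t)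
  (fun t => (tnth t (inord 1)).+1)) => //.
- exact: (computable_proj ord0).
- exact/computable_succ/computable_proj.
- by move=> i y; rewrite (tnth_nth 0) inordK.
Qed.

Lemma computable_pair n (F G : n.-tuple nat -> nat) :
  computable F -> computable G -> computable (fun t => pair_code (F t) (G t)).
Proof.
move=> FP GP.
(* Triangular numbers, written as in the body of [Cantor.to_nat]: the code of a pair is then, by
   conversion, its second component plus the triangular number of the sum. *)
pose tri := nat_rec (fun=> nat) 0 (fun i m => i.+1 + m).
have tP : computable (fun t : 1.-tuple nat => tri (thead t)).
  apply: (@computable_primrec tri (fun t => (tnth t ord0).+1 + tnth t ord_max)) => //.
  by apply: computable_add; [apply: computable_succ|]; apply: computable_proj.
by apply: (computable_add GP); apply: (computable_app1 tP); apply: computable_add.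
Qed.

(** * Register programs *)

Inductive expr := EZero | EReg (r : nat) | ESucc (r : nat) | EPred (r : nat).

Inductive cmd :=
  | Assign (r : nat) (e : expr)
  | Then (c d : cmd)
  | While (r : nat) (c : cmd).

Definition code_expr (e : expr) : nat :=
  match e with
  | EZero => pair_code 0 0
  | EReg r => pair_code 1 r
  | ESucc r => pair_code 2 r
  | EPred r => pair_code 3 r
  end.

(** Makes [cmd] an equality type and numbers the predicates attached to control states. *)
Fixpoint code_cmd (c : cmd) : nat :=
  match c with
  | Assign r e => pair_code 0 (pair_code r (code_expr e))
  | Then c d => pair_code 1 (pair_code (code_cmd c) (code_cmd d))
  | While r c => pair_code 2 (pair_code r (code_cmd c))
  end.

Lemma pair_code_inj x y x' y' :
  pair_code x y = pair_code x' y' -> x = x' /\ y = y'.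
Proof. by move/Cantor.to_nat_inj => -[-> ->]. Qed.

Lemma code_expr_inj : injective code_expr.
Proof. by case=> [|r|r|r] [|q|q|q] /= /pair_code_inj [] // _ ->. Qed.

Lemma code_cmd_inj : injective code_cmd.
Proof.
elim=> [r e|c IHc d IHd|r c IH] [q f|c' d'|q c'] /= /pair_code_inj [] // _ /pair_code_inj [].
- by move=> -> /code_expr_inj ->.
- by move=> /IHc -> /IHd ->.
- by move=> -> /IH ->.
Qed.

HB.instance Definition _ := Equality.copy cmd (inj_type code_cmd_inj).

Definition store := nat -> nat.

Definition eval (e : expr) (s : store) : nat :=
  match e with
  | EZero => 0
  | EReg r => s r
  | ESucc r => (s r).+1
  | EPred r => (s r).-1
  end.

(* The control states of a program are its continuations: the commands that
   remain to be executed. *)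
Definition tested (k : seq cmd) : nat :=
  if k is While r _ :: _ then r else 0.

(** Only a loop looks at the flag [z], so the default register of [tested] is harmless. The empty
    continuation is the halted state, a fixed point. *)
Definition next_cont (z : bool) (k : seq cmd) : seq cmd :=
  match k with
  | [::] => [::]
  | Assign _ _ :: l => l
  | Then c d :: l => [:: c, d & l]
  | While _ c :: l => if z then l else c :: k
  end.

(** Every register gets an expression, untouched ones a copy of themselves; this uniform shape is
    what [reg_rules] axiomatises. *)
Definition assigned (k : seq cmd) (q : nat) : expr :=
  if k is Assign r e :: _ then if q == r then e else EReg q else EReg q.

Definition step (x : seq cmd * store) : seq cmd * store :=
  (next_cont (x.2 (tested x.1) == 0) x.1, fun r => eval (assigned x.1 r) x.2).

(** Quantifying over the continuation is what makes runs compose. *)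
Definition runs (c : cmd) (s s' : store) : Prop :=
  forall k, exists m, iter m step (c :: k, s) = (k, s').

Definition assign (s : store) (r : nat) (e : expr) : store :=
  fun q => eval (if q == r then e else EReg q) s.

Lemma runs_assign r e s : runs (Assign r e) s (assign s r e).
Proof. by move=> k; exists 1. Qed.

Lemma runs_then c d s1 s2 s3 :
  runs c s1 s2 -> runs d s2 s3 -> runs (Then c d) s1 s3.
Proof.
move=> /[swap] k12 k23 k; have [m1 E1] := k23 (d :: k); have [m2 E2] := k12 k.
by exists (m2 + m1).+1; rewrite iterSr iterD E1.
Qed.

Lemma runs_while0 r c s : s r = 0 -> runs (While r c) s s.
Proof. by move=> s0 k; exists 1; rewrite /= /step /= s0. Qed.

Lemma runs_whileS r c s1 s2 s3 :
  s1 r != 0 -> runs c s1 s2 -> runs (While r c) s2 s3 -> runs (While r c) s1 s3.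
Proof.
move=> s0 k12 k23 k; have [m1 E1] := k12 (While r c :: k); have [m2 E2] := k23 k.
by exists (m2 + m1).+1; rewrite iterSr iterD /step /= (negPf s0) E1.
Qed.

(* [compile f a o b] reads the arguments in the registers [a], writes the
   value in register [o], and uses the registers from [b] on as workspace. *)
Fixpoint compile n (f : recfun n) : seq nat -> nat -> nat -> cmd :=
  match f with
  | Zero => fun a o b => Assign o EZero
  | Succ => fun a o b => Assign o (ESucc (head 0 a))
  | Proj _ i => fun a o b => Assign o (EReg (nth 0 a i))
  | Comp m _ f g => fun a o b =>
      foldr (fun i c => Then (compile (g i) a (b + i) (b + m)) c)
        (compile f (iota b m) o (b + m)) (enum 'I_m)
  | PrimRec _ f g => fun a o b =>
      Then (compile f (behead a) b.+1 b.+4)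
      (Then (Assign b EZero)
      (Then (Assign b.+2 (EReg (head 0 a)))
      (Then (While b.+2
        (Then (Assign b.+2 (EPred b.+2))
        (Then (compile g [:: b, b.+1 & behead a] b.+3 b.+4)
        (Then (Assign b.+1 (EReg b.+3))
          (Assign b (ESucc b))))))
      (Assign o (EReg b.+1)))))
  | Mu _ f => fun a o b =>
      Then (Assign b EZero)
      (Then (compile f (b :: a) b.+1 b.+2)
      (Then (While b.+1
        (Then (Assign b (ESucc b)) (compile f (b :: a) b.+1 b.+2)))
      (Assign o (EReg b))))
  end.

(** * Correctness of the compiler *)

Definition below (b : nat) (a : seq nat) := forall r, r \in a -> r < b.

Lemma map_agree (a : seq nat) b (s s' : store) :
  below b a -> (forall r, r < b -> s' r = s r) -> map s' a = map s a.
Proof. by move=> ab ss; apply/eq_in_map => r /ab /ss. Qed.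

Lemma below_weak a b b' : below b a -> b <= b' -> below b' a.
Proof. by move=> ab bb r /ab rb; apply: leq_trans bb. Qed.

Lemma below_behead a b : below b a -> below b (behead a).
Proof. by move=> ab r ra; apply/ab/mem_behead. Qed.

Lemma below_cons r a b : r < b -> below b a -> below b (r :: a).
Proof. by move=> rb ab q; rewrite inE => /orP[/eqP->|/ab]. Qed.

Lemma assign_same s r e : assign s r e r = eval e s.
Proof. by rewrite /assign eqxx. Qed.

Lemma assign_other s r e q : q != r -> assign s r e q = s q.
Proof. by rewrite /assign => /negPf ->. Qed.

Definition compile_spec n (f : recfun n) := forall (t : n.-tuple nat) y,
  computes f t y -> forall a o b s, map s a = t :> seq nat -> below b a ->
  o < b -> exists s', [/\ runs (compile f a o b) s s', s' o = y &
    forall r, r < b -> r != o -> s' r = s r].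

Lemma compile_comp m n (f : recfun m) (g : 'I_m -> recfun n) :
  compile_spec f -> (forall i, compile_spec (g i)) -> compile_spec (Comp f g).
Proof.
move=> IHf IHg t y /= [u [gu fu]] a o b s sa ab ob.
(* Induction on the list [l] of components still to be evaluated; those outside [l] already sit in
   their slots. *)
suff H (l : seq 'I_m) (s1 : store) :
    (forall r, r < b -> s1 r = s r) ->
    (forall i, i \notin l -> s1 (b + i) = tnth u i) ->
    exists s', [/\ runs (foldr (fun i c => Then (compile (g i) a (b + i) (b + m)) c)
        (compile f (iota b m) o (b + m)) l) s1 s', s' o = y &
      forall r, r < b -> r != o -> s' r = s r].
  by apply: H => // i; rewrite mem_enum.
elim: l s1 => [|i l IHl] s1 s1s s1u /=.
  have [|||s' [ks so ss]] := IHf _ _ fu (iota b m) o (b + m) s1.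
  - apply: (@eq_from_nth _ 0); first by rewrite size_map size_iota size_tuple.
    move=> i; rewrite size_map size_iota => im.
    rewrite (nth_map 0) ?size_iota // nth_iota // (s1u (Ordinal im)) //.
    by rewrite (tnth_nth 0).
  - by move=> r; rewrite mem_iota => /andP[].
  - exact: ltn_addr.
  exists s'; split=> // r rb ro.
  by rewrite ss ?s1s //; exact: ltn_addr.
have [||| s2 [k2 s2i s2s]] := IHg i _ _ (gu i) a (b + i) (b + m) s1.
- by rewrite (map_agree ab s1s).
- by apply: below_weak ab _; exact: leq_addr.
- by rewrite ltn_add2l.
have [||s3 [k3 s3o s3s]] := IHl s2.
- move=> r rb; rewrite s2s ?s1s //; first exact: ltn_addr.
  by rewrite neq_ltn (leq_trans rb) ?leq_addr.
- move=> j jl; case: (eqVneq j i) => [->//|ji].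
  rewrite s2s ?ltn_add2l ?eqn_add2l // s1u // inE negb_or.
  by rewrite ji.
by exists s3; split=> //; apply: runs_then k2 k3.
Qed.

Lemma compile_mu n (f : recfun n.+1) : compile_spec f -> compile_spec (Mu f).
Proof.
move=> IHf t y /= [fy fz] a o b s sa ab ob.
(* One evaluation of the body at the candidate [z]: the tested register becomes zero at [y] and
   nonzero before. *)
pose test s1 z := exists s2, [/\ runs (compile f (b :: a) b.+1 b.+2) s1 s2,
  s2 b = z, (z < y -> s2 b.+1 != 0), (z = y -> s2 b.+1 = 0) &
  forall r, r < b -> s2 r = s r].
have testP s1 z : s1 b = z -> z <= y -> (forall r, r < b -> s1 r = s r) -> test s1 z.
  move=> s1b zy s1s.
  have [w [fw w0 wy]] : exists w, [/\ computes f [tuple of z :: t] w,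
      (z < y -> w != 0) & (z = y -> w = 0)].
    case: (eqVneq z y) => [->|zny]; first by exists 0; split=> //; rewrite ltnn.
    have [|w fw] := fz z; first by lia.
    by exists w.+1; split=> // zy0; rewrite zy0 eqxx in zny.
  have [||| s2 [k2 s2o s2s]] := IHf _ _ fw (b :: a) b.+1 b.+2 s1.
  - by rewrite /= s1b (map_agree ab s1s) sa.
  - by apply: below_cons => //; apply: below_weak ab _; lia.
  - by [].
  exists s2; split=> //.
  - by rewrite s2s //; lia.
  - by rewrite s2o.
  - by rewrite s2o.
  - by move=> r rb; rewrite s2s ?s1s //; lia.
(* Here [d] is the distance from the current candidate to [y]. *)
have loop d : forall z s1, z + d = y -> s1 b = z -> (z < y -> s1 b.+1 != 0) ->
    (z = y -> s1 b.+1 = 0) -> (forall r, r < b -> s1 r = s r) ->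
    exists s2, [/\ runs (While b.+1 (Then (Assign b (ESucc b))
      (compile f (b :: a) b.+1 b.+2))) s1 s2, s2 b = y &
      forall r, r < b -> s2 r = s r].
  elim: d => [|d IHd] z s1 zd s1b s1lt s1eq s1s.
    by exists s1; split=> //; [apply/runs_while0/s1eq; lia|lia].
  have [|||s2 [k2 s2b s2lt s2eq s2s]] := testP (assign s1 b (ESucc b)) z.+1.
  - by rewrite assign_same /= s1b.
  - lia.
  - by move=> r rb; rewrite assign_other ?s1s //; lia.
  have [||||| s3 [k3 s3b s3s]] := IHd z.+1 s2; rewrite ?addSnnS //.
  exists s3; split=> //; apply: runs_whileS (s1lt _) _ k3; first lia.
  exact: runs_then (runs_assign _ _ _) k2.
have [|||s1 [k1 s1b s1lt s1eq s1s]] := testP (assign s b EZero) 0.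
- by rewrite assign_same.
- by [].
- by move=> r rb; rewrite assign_other //; lia.
have [||||| s2 [k2 s2b s2s]] := loop y 0 s1; rewrite ?add0n //.
exists (assign s2 o (EReg b)); split.
- apply: runs_then (runs_assign _ _ _) _; apply: runs_then k1 _.
  exact: runs_then k2 (runs_assign _ _ _).
- by rewrite assign_same.
- by move=> r rb ro; rewrite assign_other ?s2s.
Qed.

Lemma compile_primrec n (f : recfun n) (g : recfun n.+2) :
  compile_spec f -> compile_spec g -> compile_spec (PrimRec f g).
Proof.
move=> IHf IHg t y /= [v [fv gv ->]] {y} a o b s sa ab ob.
have sa1 : map s (behead a) = behead_tuple t :> seq nat.
  by rewrite -behead_map sa.
have sa0 : s (head 0 a) = thead t.
  have : size (map s a) = n.+1 by rewrite sa size_tuple.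
  rewrite /thead (tnth_nth 0) -sa /=.
  by case: (a).
have ab1 := below_behead ab.
have ab0 : head 0 a < b.
  by case: (a) ab => [|x a'] ab /=; [exact: leq_ltn_trans ob|apply: ab; rewrite mem_head].
(* Invariant: [b], [b.+1] and [b.+2] hold the index, the value of the recursion there, and the
   number of remaining rounds. *)
have loop d : forall i s1, i + d = thead t -> s1 b = i -> s1 b.+1 = v i ->
    s1 b.+2 = d -> (forall r, r < b -> s1 r = s r) ->
    exists s2, [/\ runs (While b.+2
        (Then (Assign b.+2 (EPred b.+2))
        (Then (compile g [:: b, b.+1 & behead a] b.+3 b.+4)
        (Then (Assign b.+1 (EReg b.+3))
          (Assign b (ESucc b)))))) s1 s2, s2 b.+1 = v (thead t) &
      forall r, r < b -> s2 r = s r].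
  elim: d => [|d IHd] i s1 id s1b s1v s1d s1s.
    exists s1; split=> //; first exact: runs_while0.
    by rewrite s1v; congr v; lia.
  pose s2 := assign s1 b.+2 (EPred b.+2).
  have s2s r : r < b.+2 -> s2 r = s1 r by move=> rb; rewrite /s2 assign_other //; lia.
  have [|||| s3 [k3 s3o s3s]] := IHg _ _ (gv i _) [:: b, b.+1 & behead a] b.+3 b.+4 s2.
  - lia.
  - rewrite /= !s2s // s1b s1v (@map_agree _ b s) ?sa1 // => r rb.
    by rewrite s2s ?s1s //; lia.
  - by do 2![apply: below_cons; first by lia]; apply: below_weak ab1 _; lia.
  - by [].
  pose s4 := assign s3 b.+1 (EReg b.+3).
  pose s5 := assign s4 b (ESucc b).
  have [||||| s6 [k6 s6v s6s]] := IHd i.+1 s5.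
  - by rewrite addSnnS.
  - rewrite /s5 assign_same /= /s4 assign_other ?s3s ?s2s ?s1b //; lia.
  - by rewrite /s5 assign_other /s4 ?assign_same //; lia.
  - rewrite /s5 assign_other /s4 ?assign_other ?s3s /s2 ?assign_same /= ?s1d //; lia.
  - by move=> r rb; rewrite /s5 assign_other /s4 ?assign_other ?s3s ?s2s ?s1s //; lia.
  exists s6; split=> //; apply: runs_whileS k6; first by rewrite s1d.
  apply: runs_then (runs_assign _ _ _) _; apply: runs_then k3 _.
  exact: runs_then (runs_assign _ _ _) (runs_assign _ _ _).
have [||| s1 [k1 s1o s1s]] := IHf _ _ fv (behead a) b.+1 b.+4 s.
- exact: sa1.
- by apply: below_weak ab1 _; lia.
- lia.
pose s2 := assign s1 b EZero; pose s3 := assign s2 b.+2 (EReg (head 0 a)).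
have [||||| s4 [k4 s4v s4s]] := loop (thead t) 0 s3.
- by [].
- by rewrite /s3 assign_other /s2 ?assign_same //; lia.
- by rewrite /s3 assign_other /s2 ?assign_other //; lia.
- by rewrite /s3 assign_same /= /s2 assign_other ?s1s ?sa0 //; lia.
- by move=> r rb; rewrite /s3 assign_other /s2 ?assign_other ?s1s //; lia.
exists (assign s4 o (EReg b.+1)); split.
- apply: runs_then k1 _; apply: runs_then (runs_assign _ _ _) _.
  apply: runs_then (runs_assign _ _ _) _; apply: runs_then k4 _.
  exact: runs_assign.
- by rewrite assign_same.
- by move=> r rb ro; rewrite assign_other ?s4s.
Qed.

Lemma compile_correct n (f : recfun n) : compile_spec f.
Proof.
elim: f => [||n' i|m n' f IHf g IHg|n' f IHf g IHg|n' f IHf].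
- move=> t y /= -> a o b s _ _ _; exists (assign s o EZero).
  by split=> [||r _ ro]; [exact: runs_assign|rewrite assign_same|rewrite assign_other].
- move=> t y /= -> a o b s sa _ _; exists (assign s o (ESucc (head 0 a))).
  split=> [||r _ ro]; [exact: runs_assign|rewrite assign_same|by rewrite assign_other].
  have : size (map s a) = 1 by rewrite sa size_tuple.
  by rewrite /thead (tnth_nth 0) -sa /=; case: (a).
- move=> t y /= -> a o b s sa _ _; exists (assign s o (EReg (nth 0 a i))).
  split=> [||r _ ro]; [exact: runs_assign|rewrite assign_same|by rewrite assign_other].
  have : size (map s a) = n' by rewrite sa size_tuple.
  by rewrite size_map (tnth_nth 0) -sa /= => sz; rewrite (nth_map 0) // sz.
- exact: compile_comp.
- exact: compile_primrec.
- exact: compile_mu.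
Qed.

(** * The finitely many control states and registers of a program *)

Fixpoint conts (c : cmd) (k : seq cmd) : seq (seq cmd) :=
  (c :: k) :: match c with
  | Assign _ _ => [::]
  | Then c d => conts c (d :: k) ++ conts d k
  | While _ d => conts d (c :: k)
  end.

Lemma head_conts c k : c :: k \in conts c k.
Proof. by case: c => *; rewrite mem_head. Qed.

(** Execution of [c] stays in [conts c k] until it exits to [k], so finitely many state predicates
    suffice. *)
Lemma cont_step z c k l : l \in conts c k -> next_cont z l \in k :: conts c k.
Proof.
elim: c k => [r e|c IHc d IHd|r c IH] k /=.
- by rewrite !inE => /eqP -> /=; rewrite eqxx.
- rewrite inE mem_cat => /or3P[/eqP->|/IHc|/IHd] /=.
  + by rewrite !inE mem_cat head_conts !orbT.
  + rewrite !inE mem_cat => /orP[/eqP ->|->]; rewrite ?orbT //.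
    by rewrite head_conts !orbT.
  + by rewrite !inE mem_cat => /orP[->|->]; rewrite ?orbT.
- rewrite inE => /orP[/eqP->|/IH].
  + by case: (z); rewrite !inE ?eqxx //= head_conts !orbT.
  + by rewrite !inE => /orP[->|->]; rewrite ?orbT.
Qed.

Definition expr_regs (e : expr) : seq nat :=
  match e with EZero => [::] | EReg r | ESucc r | EPred r => [:: r] end.

Fixpoint regs (c : cmd) : seq nat :=
  match c with
  | Assign r e => r :: expr_regs e
  | Then c d => regs c ++ regs d
  | While r c => r :: regs c
  end.

Lemma tested_conts c k l : l \in conts c k -> tested l \in 0 :: regs c.
Proof.
elim: c k => [r e|c IHc d IHd|r c IH] k /=.
- by rewrite inE => /eqP ->.
- rewrite inE mem_cat => /or3P[/eqP->//|/IHc|/IHd]; rewrite !inE mem_cat;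
  by move=> /orP[->|->]; rewrite ?orbT.
- rewrite inE => /orP[/eqP->|/IH]; rewrite !inE ?eqxx ?orbT //.
  by move=> /orP[->|->]; rewrite ?orbT.
Qed.

Lemma assigned_conts c k l r :
  l \in conts c k -> {subset expr_regs (assigned l r) <= r :: regs c}.
Proof.
elim: c k => [q e|c IHc d IHd|q c IH] k /=.
- rewrite inE => /eqP -> /= x.
  by case: eqP => _; rewrite !inE => ->; rewrite ?orbT.
- rewrite inE mem_cat => /or3P[/eqP-> x|/IHc H x /H|/IHd H x /H].
  + by rewrite !inE => ->.
  + by rewrite !inE mem_cat => /orP[->|->]; rewrite ?orbT.
  + by rewrite !inE mem_cat => /orP[->|->]; rewrite ?orbT.
- rewrite inE => /orP[/eqP->|/IH H] x; first by rewrite !inE => ->.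
  by move/H; rewrite !inE => /orP[->|->]; rewrite ?orbT.
Qed.

(** * Clauses *)

(* Unary predicates at the grid point of column [i] and row (time) [j]:
   [Cell a p] records j mod 4 and the parity of i, [Lt r] and [Le r] hold when
   i < v, resp. i <= v, for the value v of register [r] at time [j], and
   [Input i] marks the point of column [i] in row 0. *)
Inductive sym :=
  | Cell (a : nat) (p : bool)
  | Left
  | End
  | State (k : seq cmd)
  | Lt (r : nat)
  | Le (r : nat)
  | Input (i : nat).

Definition sym_code (s : sym) : nat :=
  match s with
  | Cell a p => pair_code 0 (pair_code a (nat_of_bool p))
  | Left => pair_code 1 0
  | End => pair_code 2 0
  | State k => pair_code 3 (code_seq (map code_cmd k))
  | Lt r => pair_code 4 r
  | Le r => pair_code 5 r
  | Input i => pair_code 6 i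
  end.

Lemma sym_code_inj : injective sym_code.
Proof.
case=> [a p|||k|r|r|i] [b q|||l|r'|r'|i'] /= /pair_code_inj [] // _.
- by move=> /pair_code_inj [-> pq]; case: p q pq => -[].
- by move=> /code_seq_inj /(inj_map code_cmd_inj) ->.
- by move=> ->.
- by move=> ->.
- by move=> ->.
Qed.

Definition lit : Type := sym * bool.
Definition neg (l : lit) : lit := (l.1, ~~ l.2).
(** Falsity in the shape of a conclusion of [Forall], needed for contraposed rules. *)
Definition absurd : seq lit := [:: (Left, true); (Left, false)].

(* The Boolean [c] selects the first or the second transitive relation. *)
Inductive clause :=
  | Start (C : seq lit)
  | Local (A C : seq lit)
  | Exist (A : seq lit) (c : bool) (C : seq lit)
  | Forall (A : seq lit) (c : bool) (B C : seq lit)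
  | Transfer (A : seq lit) (c : bool) (B : seq lit) (d : bool)
  | Unique (A : seq lit) (c : bool) (B : seq lit).

Section ClauseSemantics.
Variables (D : Type) (P : sym -> D -> Prop) (T : bool -> D -> D -> Prop).

Definition lit_sem (x : D) (l : lit) : Prop :=
  if l.2 then P l.1 x else ~ P l.1 x.

Fixpoint lits_sem (x : D) (A : seq lit) : Prop :=
  if A is l :: A then lit_sem x l /\ lits_sem x A else True.

Definition clause_sem (cl : clause) : Prop :=
  match cl with
  | Start C => exists x, lits_sem x C
  | Local A C => forall x, lits_sem x A -> lits_sem x C
  | Exist A c C => forall x, lits_sem x A -> exists y, T c x y /\ lits_sem y C
  | Forall A c B C => forall x y,
      lits_sem x A -> T c x y -> lits_sem y B -> lits_sem y C
  | Transfer A c B d => forall x y,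
      lits_sem x A -> T c x y -> lits_sem y B -> T d x y
  | Unique A c B => forall x y,
      lits_sem x A -> T c x y -> lits_sem y B -> x = y
  end.

Fixpoint all_sem (th : seq clause) : Prop :=
  if th is cl :: th then clause_sem cl /\ all_sem th else True.

Lemma all_sem_cat th1 th2 : all_sem (th1 ++ th2) <-> all_sem th1 /\ all_sem th2.
Proof. by elim: th1 => [|cl th1 IH] /=; tauto. Qed.

Lemma all_sem_flatten (X : eqType) (F : X -> seq clause) (xs : seq X) :
  all_sem (flatten (map F xs)) <-> forall x, x \in xs -> all_sem (F x).
Proof.
elim: xs => [|x xs IH] //=; rewrite all_sem_cat IH; split=> [[Fx Fxs] y|H].
  by rewrite inE => /orP[/eqP->|/Fxs].
by split=> [|y yxs]; apply: H; rewrite inE ?eqxx // yxs orbT.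
Qed.

End ClauseSemantics.

(* The empty conjunction is a tautology without variables, which belongs to
   FL^[m] for every m. *)
Definition top : formula := Imp (Atom 0 [::]) (Atom 0 [::]).

Definition lit_form (x : nat) (l : lit) : formula :=
  let atom := Atom (sym_code l.1) [:: x] in if l.2 then atom else Not atom.

Definition lits_form (x : nat) (A : seq lit) : formula :=
  foldr (fun l phi => And (lit_form x l) phi) top A.

(** The Boolean is coerced to the index 0 or 1 of a distinguished symbol; unary symbols may share
    these indices, since the arity is part of a symbol. *)
Definition trans_form (c : bool) : formula := Atom c [:: 1; 2].

(** Flutedness allows no unary atom on the first variable below the second quantifier, and no edge
    from the second variable to the first. Conditions on the first point therefore stand outside,
    and edges are only followed forwards. *)
Definition clause_form (cl : clause) : formula :=
  let all2 A c B phi := All 1 (Imp (lits_form 1 A)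
    (All 2 (Imp (And (trans_form c) (lits_form 2 B)) phi))) in
  match cl with
  | Start C => Ex 1 (lits_form 1 C)
  | Local A C => All 1 (Imp (lits_form 1 A) (lits_form 1 C))
  | Exist A c C => All 1 (Imp (lits_form 1 A)
      (Ex 2 (And (trans_form c) (lits_form 2 C))))
  | Forall A c B C => all2 A c B (lits_form 2 C)
  | Transfer A c B d => all2 A c B (trans_form d)
  | Unique A c B => all2 A c B (Equal 1 2)
  end.

Definition conj_form (th : seq clause) : formula :=
  foldr (fun cl phi => And (clause_form cl) phi) top th.

Definition sym_pred (M : structure) (s : sym) (x : M) : Prop :=
  interp (sym_code s) [:: x].

Definition trans_rel (M : structure) (c : bool) (x y : M) : Prop :=
  interp c [:: x; y].

Lemma holds_lits (M : structure) (v : nat -> M) x A :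
  holds v (lits_form x A) <-> lits_sem (@sym_pred M) (v x) A.
Proof.
elim: A => [|[s b] A IH] /=; first tauto.
by rewrite IH /lit_sem /=; case: b.
Qed.

Lemma holds_clause (M : structure) (v : nat -> M) cl :
  holds v (clause_form cl) <-> clause_sem (@sym_pred M) (@trans_rel M) cl.
Proof.
have H1 x A : holds (update v 1 x) (lits_form 1 A) <-> lits_sem (@sym_pred M) x A.
  exact: holds_lits.
have H2 x y A : holds (update (update v 1 x) 2 y) (lits_form 2 A)
    <-> lits_sem (@sym_pred M) y A.
  exact: holds_lits.
case: cl => [C|A C|A c C|A c B C|A c B d|A c B] /=.
- by split=> -[x /H1 xC]; exists x => //; apply/H1.
- by split=> H x /H1 /H /H1.
- by split=> H x /H1 /H [y [xy /H2 yC]]; exists y; split=> //; exact/H2.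
- split=> [H x y /H1 xA xy /H2 yB|H x /H1 xA y [xy /H2 yB]]; last exact/H2/(H x).
  by apply/H2; apply: (H x xA y).
- split=> [H x y /H1 xA xy /H2 yB|H x /H1 xA y [xy /H2 yB]]; last exact: (H x).
  exact: (H x xA y).
- split=> [H x y /H1 xA xy /H2 yB|H x /H1 xA y [xy /H2 yB]]; last exact: (H x).
  exact: (H x xA y).
Qed.

Lemma holds_conj (M : structure) (v : nat -> M) th :
  holds v (conj_form th) <-> all_sem (@sym_pred M) (@trans_rel M) th.
Proof. by elim: th => [|cl th IH] /=; [tauto|rewrite IH holds_clause]. Qed.

(** * Membership in the two-variable fluted fragment *)

Lemma fluted_top m : fluted m top.
Proof.
have H : fluted m (Atom 0 (index_iota m.+1 m.+1)) by apply: fluted_atom; rewrite leqnn.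
rewrite /index_iota subnn in H.
exact: fluted_imp.
Qed.

Lemma fluted_lits m A : 0 < m -> fluted m (lits_form m A).
Proof.
move=> m0; elim: A => [|[s b] A IH]; first exact: fluted_top.
apply: fluted_and IH; rewrite /lit_form /=.
have H : fluted m (Atom (sym_code s) [:: m]).
  have -> : [:: m] = index_iota m m.+1 by rewrite /index_iota subSnn.
  by apply: fluted_atom; rewrite m0 leqnSn.
by case: b => //; apply: fluted_not.
Qed.

Lemma fluted_trans c : fluted 2 (trans_form c).
Proof. by apply: (@fluted_atom 2 1). Qed.

Lemma fluted_clause cl : fluted 0 (clause_form cl).
Proof.
by case: cl => [C|A C|A c C|A c B C|A c B d|A c B];
  do 6?[exact: fluted_lits|exact: fluted_trans|exact: fluted_equal
       |apply: fluted_all|apply: fluted_ex|apply: fluted_imp|apply: fluted_and].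
Qed.

Lemma vars_lits x A : {subset vars (lits_form x A) <= [:: x]}.
Proof.
elim: A => [|[s b] A IH] y //=; rewrite mem_cat => /orP[|/IH //].
by case: b.
Qed.

Lemma vars_clause cl : {subset vars (clause_form cl) <= [:: 1; 2]}.
Proof.
have H1 A : {subset vars (lits_form 1 A) <= [:: 1; 2]}.
  by move=> y /vars_lits; rewrite !inE => ->.
have H2 A : {subset vars (lits_form 2 A) <= [:: 1; 2]}.
  by move=> y /vars_lits; rewrite !inE => ->; rewrite orbT.
move=> y; case: cl => [C|A C|A c C|A c B C|A c B d|A c B] /=;
rewrite !(inE, mem_cat); repeat (case/orP; try by move=> -> //; rewrite ?orbT);
by [move/H1; rewrite !inE|move/H2; rewrite !inE|move=> ->; rewrite ?orbT].
Qed.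

Definition FL2_sentence (phi : formula) : Prop :=
  fluted 0 phi /\ {subset vars phi <= [:: 1; 2]}.

Lemma FL2_sentence_top : FL2_sentence top.
Proof. by split; first exact: fluted_top. Qed.

Lemma FL2_sentence_clause cl : FL2_sentence (clause_form cl).
Proof. by split; [exact: fluted_clause|exact: vars_clause]. Qed.

Lemma FL2_sentence_and phi psi :
  FL2_sentence phi -> FL2_sentence psi -> FL2_sentence (And phi psi).
Proof.
move=> [f1 v1] [f2 v2]; split; first exact: fluted_and.
by move=> y /=; rewrite mem_cat => /orP[/v1|/v2].
Qed.

Lemma FL2_sentence_conj th : FL2_sentence (conj_form th).
Proof.
elim: th => [|cl th IH]; first exact: FL2_sentence_top.
exact: FL2_sentence_and (FL2_sentence_clause cl) IH.
Qed.

Lemma FL2_sentenceP phi : FL2_sentence phi -> FL2 phi.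
Proof.
move=> [f v]; split; first by exists 0.
apply: (@uniq_leq_size _ _ [:: 1; 2]); first exact: undup_uniq.
by move=> y; rewrite mem_undup => /v.
Qed.

(** * Sentences describing the input *)

Definition input_step (i : nat) : seq clause :=
  let next_input p := Forall [:: (Input i, true); (Cell 0 p, true)] p
    [:: (Cell 0 (~~ p), true)] [:: (Input i.+1, true)] in
  [:: Local [:: (Input i, true)] [:: (Lt 0, true)];
      next_input false; next_input true].

(** Recursion on [n] itself makes the code of the conjunction a primitive recursive function of
    [n]. *)
Fixpoint input_steps (n : nat) : formula :=
  if n is i.+1 then And (conj_form (input_step i)) (input_steps i) else top.

Definition input_form (n : nat) : formula :=
  And (clause_form (Local [:: (Input n, true)] [:: (Lt 0, false)]))
    (input_steps n).

Lemma FL2_sentence_input n : FL2_sentence (input_form n).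
Proof.
apply: FL2_sentence_and (FL2_sentence_clause _) _.
elim: n => [|n IH]; first exact: FL2_sentence_top.
exact: FL2_sentence_and (FL2_sentence_conj (input_step n)) IH.
Qed.

Lemma holds_input (M : structure) (v : nat -> M) n :
  holds v (input_form n) <->
  clause_sem (@sym_pred M) (@trans_rel M)
    (Local [:: (Input n, true)] [:: (Lt 0, false)]) /\
  forall i, i < n -> all_sem (@sym_pred M) (@trans_rel M) (input_step i).
Proof.
rewrite -(holds_clause v); suff H : holds v (input_steps n) <->
  forall i, i < n -> all_sem (@sym_pred M) (@trans_rel M) (input_step i).
  by split=> -[Hn /H]; split.
elim: n => [|n IH] //; first by split=> // _ i.
have -> : holds v (input_steps n.+1) <->
  holds v (conj_form (input_step n)) /\ holds v (input_steps n) by [].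
rewrite IH holds_conj; split=> [[Hn H] i|H].
  by rewrite ltnS leq_eqVlt => /orP[/eqP->|/H].
by split=> [|i lin]; apply: H; [exact: ltnSn|exact: ltnW].
Qed.

Local Opaque Cantor.to_nat.

(** The code of [input_step i] arises from [i] by constants, successors and pairings. *)
Lemma computable_input_form (n : nat) (F : n.-tuple nat -> nat) :
  computable F -> computable (fun t => code (input_form (F t))).
Proof.
move=> FP; have sP : computable (fun t : 1.-tuple nat => code (input_steps (thead t))).
  apply: (@computable_primrec (fun i => code (input_steps i)) (fun t =>
    pair_code 3 (pair_code (code (conj_form (input_step (tnth t ord0)))) (tnth t ord_max)))) => //.
  rewrite /=.
  repeat first [exact: computable_const | exact: computable_proj
    | apply: computable_pair | apply: computable_succ].
suff fP : computable (fun t : 1.-tuple nat => code (input_form (thead t))).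
  exact: (@computable_app1 n (fun m => code (input_form m)) F fP FP).
rewrite /=.
repeat first [exact: computable_const | exact: sP | exact: (computable_proj ord0)
    | apply: computable_pair | apply: computable_succ].
Qed.

(** * The sentence of a program *)

HB.instance Definition _ := Equality.copy sym (inj_type sym_code_inj).

Local Notation yes s := ((s, true) : lit).
Local Notation no s := ((s, false) : lit).

(** Register 0 holds the input and is the default of [tested]; register 1 holds the output. *)
Definition registers (c : cmd) : seq nat := [:: 0, 1 & regs c].
Definition states (c : cmd) : seq (seq cmd) := [::] :: conts c [::].

(** An even row has edges to both adjacent rows, which are both odd; counting modulo 4 tells them
    apart and keeps the parity. *)
Definition nxt (a : nat) : nat := a.+1 %% 4.

(* Vertical edges point from even to odd rows, so that transitivity never
   relates points that are more than one row apart. *)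
Definition src (a : nat) : nat := if odd a then nxt a else a.
Definition dst (a : nat) : nat := if odd a then a else nxt a.

(* Columns i and i + 1 are linked by the transitive relation number [odd i];
   [Unique] turns the resulting chains of links into two-element cliques.  A
   vertical edge of column i is obtained in the relation of the cell on its
   left and transferred to that of the cell on its right. *)
Definition cell_clauses (a : nat) (p : bool) : seq clause := [::
  Exist [:: yes (Cell a p); no End] p [:: yes (Cell a (~~ p)); no Left];
  Exist [:: yes (Cell a (~~ p)); no Left] p [:: yes (Cell a p)];
  Unique [:: yes (Cell a p)] false [:: yes (Cell a p)];
  Unique [:: yes (Cell a p)] true [:: yes (Cell a p)];
  Transfer [:: yes (Cell (src a) p)] (~~ p) [:: yes (Cell (dst a) p)] p].

(** Above an odd row the new point is created by an upward edge, against the required orientation.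
    This clause supplies an edge back down in the same relation, and [Unique] identifies its target
    with the original point. Row 0 has nothing below it. *)
Definition left_clauses (a : nat) : seq clause :=
  if odd a then
    [:: Exist [:: yes Left; yes (Cell (nxt a) false); no (Input 0)] true
          [:: yes Left; yes (Cell a false)]]
  else [::].

(** A halted row creates nothing, which is what permits a finite model. *)
Definition grow_clauses (a : nat) (k : seq cmd) : seq clause :=
  if k is _ :: _ then
    [:: Exist [:: yes Left; yes (Cell a false); yes (State k)] (odd a)
          [:: yes Left; yes (Cell (nxt a) false); no (Input 0)]]
  else [::].

Definition state_clause (a : nat) (p : bool) (k : seq cmd) : clause :=
  Forall [:: yes (Cell a p); yes (State k)] p
    [:: yes (Cell a (~~ p))] [:: yes (State k)].

(** The condition [i < v] in one column is [i + 1 <= v] in the next. With [Le] available, successor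
    and predecessor become rules inside a single column. *)
Definition shift_clauses (a : nat) (p : bool) (r : nat) : seq clause :=
  [:: Forall [:: yes (Cell a p); yes (Lt r)] p
        [:: yes (Cell a (~~ p))] [:: yes (Le r)];
      Forall [:: yes (Cell a p); no (Lt r)] p
        [:: yes (Cell a (~~ p))] [:: no (Le r)]].

Definition reg_clauses (r : nat) : seq clause :=
  [:: Local [:: yes Left] [:: yes (Le r)];
      Local [:: yes End] [:: no (Lt r)];
      Local [:: no (Le r)] [:: no (Lt r)]].

Definition zero_clause (r : nat) : clause :=
  Local [:: yes (Input 0)] [:: no (Lt r)].

(* The rule (A, b) requires [b] at every point above a point satisfying [A];
   it is contraposed where the vertical edges point downwards. *)
Definition rule : Type := (seq lit * lit)%type.

Definition rule_clause (a : nat) (p : bool) (u : rule) : clause :=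
  if odd a then
    Forall [:: yes (Cell (nxt a) p); neg u.2] p (yes (Cell a p) :: u.1) absurd
  else
    Forall (yes (Cell a p) :: u.1) p [:: yes (Cell (nxt a) p)] [:: u.2].

Definition end_rules : seq rule :=
  [:: ([:: yes End], yes End); ([:: no End], no End)].

Definition state_rules (k : seq cmd) : seq rule :=
  [:: ([:: yes (State k); yes Left; no (Lt (tested k))], yes (State (next_cont true k)));
      ([:: yes (State k); yes Left; yes (Lt (tested k))], yes (State (next_cont false k)))].

(** The successor uses that [i < v + 1] iff [i <= v], the predecessor that [i <= v - 1] iff [i < v];
    the latter fails for [i = v = 0] with truncated subtraction, hence [no Left]. *)
Definition reg_rules (k : seq cmd) (r : nat) : seq rule :=
  match assigned k r with
  | EZero => [:: ([:: yes (State k)], no (Lt r))]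
  | EReg q => [:: ([:: yes (State k); yes (Lt q)], yes (Lt r));
                  ([:: yes (State k); no (Lt q)], no (Lt r))]
  | ESucc q => [:: ([:: yes (State k); yes (Le q)], yes (Lt r));
                   ([:: yes (State k); no (Le q)], no (Lt r))]
  | EPred q => [:: ([:: yes (State k); no Left; yes (Lt q)], yes (Le r));
                   ([:: yes (State k); no Left; no (Lt q)], no (Le r))]
  end.

Definition rules (c : cmd) : seq rule :=
  end_rules ++ flatten [seq state_rules k | k <- states c] ++
  flatten [seq flatten [seq reg_rules k r | r <- registers c] | k <- states c].

(** The last clause makes halting with a nonzero output contradictory. *)
Definition init_clauses (c : cmd) : seq clause :=
  [:: Start [:: yes (Input 0)];
      Local [:: yes (Input 0)] [:: yes (Cell 0 false); yes Left; yes (State [:: c])];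
      Local [:: yes (State [::]); yes Left] [:: no (Lt 1)]].

Definition column_clauses (c : cmd) (a : nat) (p : bool) : seq clause :=
  cell_clauses a p ++
  (flatten [seq shift_clauses a p r | r <- registers c] ++
  ([seq state_clause a p k | k <- states c] ++
  [seq rule_clause a p u | u <- rules c])).

Definition row_clauses (c : cmd) (a : nat) : seq clause :=
  left_clauses a ++ (flatten [seq grow_clauses a k | k <- states c] ++
  flatten [seq column_clauses c a p | p <- [:: false; true]]).

Definition theory (c : cmd) : seq clause :=
  init_clauses c ++
  ([seq zero_clause r | r <- registers c & r != 0] ++
  (flatten [seq reg_clauses r | r <- registers c] ++
  flatten [seq row_clauses c a | a <- iota 0 4])).

Lemma states_next c z k : k \in states c -> next_cont z k \in states c.
Proof. by rewrite inE => /orP[/eqP->|/cont_step]. Qed.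

Lemma tested_registers c k : k \in states c -> tested k \in registers c.
Proof.
rewrite inE => /orP[/eqP->//|/tested_conts].
by rewrite !inE => /orP[->|->]; rewrite ?orbT.
Qed.

Lemma assigned_registers c k r : k \in states c -> r \in registers c ->
  {subset expr_regs (assigned k r) <= registers c}.
Proof.
rewrite inE => /orP[/eqP-> rc x|/assigned_conts H rc x /H].
  by rewrite inE => /eqP ->.
by rewrite inE => /orP[/eqP->//|]; rewrite !inE => ->; rewrite !orbT.
Qed.

Section Theory.
Variables (D : Type) (P : sym -> D -> Prop) (T : bool -> D -> D -> Prop).

Lemma all_sem_map (X : eqType) (F : X -> clause) (xs : seq X) :
  all_sem P T (map F xs) <-> forall x, x \in xs -> clause_sem P T (F x).
Proof.
elim: xs => [|x xs IH] //=; rewrite IH; split=> [[Fx Fxs] y|H].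
  by rewrite inE => /orP[/eqP->|/Fxs].
by split=> [|y yxs]; apply: H; rewrite inE ?eqxx // yxs orbT.
Qed.

Record theory_sem (c : cmd) : Prop := TheorySem {
  sem_init : all_sem P T (init_clauses c);
  sem_zero : forall r, r \in registers c -> r != 0 -> clause_sem P T (zero_clause r);
  sem_reg : forall r, r \in registers c -> all_sem P T (reg_clauses r);
  sem_left : forall a, a < 4 -> all_sem P T (left_clauses a);
  sem_grow : forall a k, a < 4 -> k \in states c -> all_sem P T (grow_clauses a k);
  sem_cell : forall a p, a < 4 -> all_sem P T (cell_clauses a p);
  sem_shift : forall a p r, a < 4 -> r \in registers c ->
    all_sem P T (shift_clauses a p r);
  sem_state : forall a p k, a < 4 -> k \in states c ->
    clause_sem P T (state_clause a p k);
  sem_rule : forall a p u, a < 4 -> u \in rules c ->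
    clause_sem P T (rule_clause a p u)
}.

Lemma all_sem_theory c : all_sem P T (theory c) <-> theory_sem c.
Proof.
have col a p : all_sem P T (column_clauses c a p) <->
  [/\ all_sem P T (cell_clauses a p),
      forall r, r \in registers c -> all_sem P T (shift_clauses a p r),
      forall k, k \in states c -> clause_sem P T (state_clause a p k)
    & forall u, u \in rules c -> clause_sem P T (rule_clause a p u)].
  split=> [/all_sem_cat[H1 /all_sem_cat[/all_sem_flatten H2]]|[H1 H2 H3 H4]].
    by move=> /all_sem_cat[/all_sem_map H3 /all_sem_map H4].
  apply/all_sem_cat; split=> //; apply/all_sem_cat; split; first exact/all_sem_flatten.
  by apply/all_sem_cat; split; exact/all_sem_map.
have row a : all_sem P T (row_clauses c a) <->
  [/\ all_sem P T (left_clauses a),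
      forall k, k \in states c -> all_sem P T (grow_clauses a k)
    & forall p, all_sem P T (column_clauses c a p)].
  split=> [/all_sem_cat[H1 /all_sem_cat[/all_sem_flatten H2 /all_sem_flatten H3]]|[H1 H2 H3]].
    by split=> // p; apply: H3; case: p.
  apply/all_sem_cat; split=> //; apply/all_sem_cat; split; exact/all_sem_flatten.
split.
  move=> /all_sem_cat[H1 /all_sem_cat[/all_sem_map H2]].
  move=> /all_sem_cat[/all_sem_flatten H3 /all_sem_flatten H4].
  have {}H4 a : a < 4 -> all_sem P T (row_clauses c a).
    by move=> a4; apply: H4; rewrite mem_iota.
  split=> //.
  - by move=> r rc r0; apply: H2; rewrite mem_filter r0.
  - by move=> a /H4 /row [].
  - by move=> a k /H4 /row [_ H _]; apply: H.
  - by move=> a p /H4 /row [_ _ /(_ p) /col []].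
  - by move=> a p r /H4 /row [_ _ /(_ p) /col [_ H _ _]]; apply: H.
  - by move=> a p k /H4 /row [_ _ /(_ p) /col [_ _ H _]]; apply: H.
  - by move=> a p u /H4 /row [_ _ /(_ p) /col [_ _ _ H]]; apply: H.
case=> H1 H2 H3 H4 H5 H6 H7 H8 H9.
apply/all_sem_cat; split=> //; apply/all_sem_cat; split.
  by apply/all_sem_map => r; rewrite mem_filter => /andP[r0 /H2]; apply.
apply/all_sem_cat; split; apply/all_sem_flatten => // a; rewrite mem_iota => /= a4.
apply/row; split=> [|k kc|p]; [exact: H4|exact: H5|apply/col].
by split=> [|r rc|k kc|u uc]; [exact: H6|exact: H7|exact: H8|exact: H9].
Qed.

End Theory.

(** * Runs in a model *)

Lemma mem_second (X : eqType) (x y : X) : y \in [:: x; y].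
Proof. by rewrite !inE eqxx orbT. Qed.

Lemma nxt_lt a : nxt a < 4.
Proof. exact: ltn_pmod. Qed.

Lemma iter_step_halt m s : iter m step ([::], s) = ([::], s).
Proof. by elim: m => [|m IH] //; rewrite iterS IH. Qed.

Definition input_store (n : nat) : store := fun r => if r == 0 then n else 0.

Section Soundness.
Variables (D : Type) (P : sym -> D -> Prop) (T : bool -> D -> D -> Prop).
Variables (c : cmd) (n : nat).
Hypothesis T_trans : forall b x y z, T b x y -> T b y z -> T b x z.
Hypothesis th : theory_sem P T c.
Hypothesis input_last : clause_sem P T (Local [:: yes (Input n)] [:: no (Lt 0)]).
Hypothesis input_next : forall i, i < n -> all_sem P T (input_step i).

Definition vedge (a : nat) (p : bool) (x y : D) : Prop :=
  if odd a then T p y x else T p x y.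

Lemma lit_sem_neg x l : ~ lit_sem P x l -> lit_sem P x (neg l).
Proof. by case: l => t [] //= /NNPP. Qed.

Lemma vertical_rule a p x y A b : a < 4 -> (A, b) \in rules c ->
  P (Cell a p) x -> P (Cell (nxt a) p) y -> vedge a p x y ->
  lits_sem P x A -> lit_sem P y b.
Proof.
move=> a4 /(sem_rule th p a4); rewrite /rule_clause /vedge.
case: (odd a) => /= H ax ay xy xA; last by case: (H x y).
case: (classic (lit_sem P y b)) => // yb.
have yb' := lit_sem_neg yb.
by have [|||? []] := H y x.
Qed.

Lemma vedge_transfer a p x y : a < 4 ->
  P (Cell a p) x -> P (Cell (nxt a) p) y ->
  (if odd a then T (~~ p) y x else T (~~ p) x y) -> vedge a p x y.
Proof.
move=> a4 ax ay; have [_ [_ [_ [_ [H _]]]]] := sem_cell th p a4.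
rewrite /= /src /dst in H; rewrite /vedge.
by case: (odd a) H => H xy; apply: H.
Qed.

(* Only the columns up to the first one in [End] carry information. *)
Definition live (f : nat -> D) (i : nat) : Prop :=
  forall i', i' < i -> ~ P End (f i').

Lemma liveS f i : live f i.+1 <-> live f i /\ ~ P End (f i).
Proof.
split=> [H|[H Hi] i']; first by split=> [i' lt_i'i|]; apply: H; lia.
by rewrite ltnS leq_eqVlt => /orP[/eqP->|/H].
Qed.

(** The trace of a row in an arbitrary model, where [End] may never occur. Liveness at [i.+1] means
    that [f i] is not an end either, so that its right link exists. *)
Record strand (a : nat) (f : nat -> D) : Prop := Strand {
  strand_cell : forall i, live f i -> P (Cell a (odd i)) (f i);
  strand_left : forall i, live f i.+1 -> ~ P Left (f i.+1);
  strand_right : forall i, live f i.+1 -> T (odd i) (f i) (f i.+1);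
  strand_back : forall i, live f i.+1 -> T (odd i) (f i.+1) (f i)
}.

(** A point [y] creates [z] on its right and [z] creates [y'] on its left in the same relation.
    Transitivity relates [y] to [y'], and [Unique] makes them equal, so the link goes both ways. *)
Lemma strand_from a x : a < 4 -> P (Cell a false) x ->
  exists f, f 0 = x /\ strand a f.
Proof.
move=> a4 ax.
have [g gP] : exists g : bool * D -> D, forall px,
    P (Cell a px.1) px.2 -> ~ P End px.2 ->
    [/\ P (Cell a (~~ px.1)) (g px), ~ P Left (g px),
        T px.1 px.2 (g px) & T px.1 (g px) px.2].
  apply: (choice (fun px y => P (Cell a px.1) px.2 -> ~ P End px.2 ->
    [/\ P (Cell a (~~ px.1)) y, ~ P Left y, T px.1 px.2 y & T px.1 y px.2])).
  move=> [p y] /=.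
  case: (classic (P (Cell a p) y /\ ~ P End y)) => [[ay ey]|]; last first.
    (* Where no neighbour is required, the choice function takes the point itself as a dummy
       value. *)
    by move=> H; exists y => ay ey; case: H.
  have [/= H1 [H2 [H3 [H4 _]]]] := sem_cell th p a4.
  have [//|z [yz [az [lz _]]]] := H1 y.
  have [//|y' [zy' [ay' _]]] := H2 z.
  suff E : y = y' by exists z => _ _; split=> //; rewrite E.
  have := T_trans yz zy'; case: (p) H3 H4 ay ay' => H3 H4 ay ay' yy'; first exact: H4.
  exact: H3.
pose f := fix f i := if i is j.+1 then g (odd j, f j) else x.
have cell i : live f i -> P (Cell a (odd i)) (f i).
  elim: i => [|i IH] //= /liveS[/IH ai ei].
  by have [] := gP (odd i, f i) ai ei.
exists f; split=> //.
by split=> // i /liveS[/cell ai ei]; have [] := gP (odd i, f i) ai ei.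
Qed.

Lemma strand_state a k f : a < 4 -> k \in states c -> strand a f ->
  P (State k) (f 0) -> forall i, live f i -> P (State k) (f i).
Proof.
move=> a4 kc fs f0; elim=> [|i IH] // li; have /liveS[/[dup] li0 /IH ki _] := li.
have [|||] // := sem_state th (p := odd i) a4 kc (x := f i) (y := f i.+1).
- by split=> //; exact: strand_cell fs _ li0.
- exact: strand_right fs _ li.
- by split=> //; exact: (strand_cell fs li).
Qed.

Lemma strand_le a r f i : a < 4 -> r \in registers c -> strand a f ->
  live f i.+1 -> (P (Le r) (f i.+1) <-> P (Lt r) (f i)).
Proof.
move=> a4 rc fs li; have /liveS[li0 _] := li.
have [/= H1 [H2 _]] := sem_shift th (odd i) a4 rc.
have ai := strand_cell fs li0; have aj : P (Cell a (~~ odd i)) _ := strand_cell fs li.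
have ij := strand_right fs li.
split=> [lei|lti]; last by have [|||] // := H1 (f i) (f i.+1).
by case: (classic (P (Lt r) (f i))) => // lti; have [|||] // := H2 (f i) (f i.+1).
Qed.

Record row (a : nat) (k : seq cmd) (s : store) (f : nat -> D) : Prop := Row {
  row_strand : strand a f;
  row_left : P Left (f 0);
  row_state : P (State k) (f 0);
  row_lt : forall i r, r \in registers c -> live f i ->
    (P (Lt r) (f i) <-> i < s r)
}.

Lemma row_le a k s f i r : a < 4 -> row a k s f -> r \in registers c ->
  live f i -> (P (Le r) (f i) <-> i <= s r).
Proof.
move=> a4 fr rc; case: i => [|i] li.
  split=> // _; have [/= H _] := sem_reg th rc.
  by have [|] // := H (f 0); split=> //; exact: row_left fr.
rewrite (strand_le a4 rc (row_strand fr) li).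
by apply: (row_lt fr) => //; have /liveS[] := li.
Qed.

Lemma end_lt x r : r \in registers c -> P End x -> ~ P (Lt r) x.
Proof. by move=> rc ex; have [_ [/= H _]] := sem_reg th rc; case: (H x). Qed.

Lemma rule_state u k : k \in states c -> u \in state_rules k -> u \in rules c.
Proof.
move=> kc uk; rewrite /rules 2!mem_cat; apply/or3P/Or32.
by apply/flatten_mapP; exists k.
Qed.

Lemma rule_reg u k r : k \in states c -> r \in registers c ->
  u \in reg_rules k r -> u \in rules c.
Proof.
move=> kc rc uk; rewrite /rules 2!mem_cat; apply/or3P/Or33.
by apply/flatten_mapP; exists k => //; apply/flatten_mapP; exists r.
Qed.

Lemma end_up a p x y : a < 4 -> P (Cell a p) x -> P (Cell (nxt a) p) y ->
  vedge a p x y -> (P End x <-> P End y).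
Proof.
move=> a4 ax ay xy; split=> [ex|ey].
  by apply: (vertical_rule a4 _ ax ay xy (A := [:: yes End]) (b := yes End)).
case: (classic (P End x)) => // ex.
have //: lit_sem P y (no End).
by apply: (vertical_rule a4 _ ax ay xy (A := [:: no End])).
Qed.

Lemma strand_next a k f : a < 4 -> k \in states c -> k != [::] -> strand a f ->
  P Left (f 0) -> P (State k) (f 0) ->
  exists f', [/\ strand (nxt a) f', P Left (f' 0) &
    forall i, live f' i -> live f i /\ vedge a (odd i) (f i) (f' i)].
Proof.
move=> a4 kc k0 fs f0 fk; have a0 : P (Cell a false) (f 0) by exact: (strand_cell fs (i := 0)).
have [y [ly ay xy]] : exists y, [/\ P Left y, P (Cell (nxt a) false) y &
    vedge a false (f 0) y].
  have := sem_grow th a4 kc; case: (k) k0 fk => //= d l _ fk [H _].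
  have [//|y [xy [ly [ay [iy _]]]]] := H (f 0).
  exists y; split=> //; rewrite /vedge; case: ifP => oa; rewrite oa in xy; last by [].
  have := sem_left th a4; rewrite /left_clauses oa => -[/= H' _].
  have [//|x' [yx' [lx' [ax' _]]]] := H' y.
  have [_ [_ [_ [/= U _]]]] := sem_cell th false a4.
  (* The path up to [y] and down to [x'] lies in the second relation and joins two cells of the same
     kind. *)
  have E : f 0 = x' by apply: U => //; apply: T_trans xy yx'.
  rewrite -E in yx'.
  by have := @vedge_transfer a false (f 0) y a4 a0 ay; rewrite /vedge oa; apply.
have [f' [f'0 fs']] := strand_from (nxt_lt a) ay.
exists f'; split; rewrite ?f'0 //.
elim=> [|i IH] li'; first by rewrite f'0.
have /liveS[/[dup] li0' /IH [li0 vi] ei'] := li'.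
have ei : ~ P End (f i).
  by rewrite (end_up a4 (strand_cell fs li0) (strand_cell fs' li0') vi).
have li : live f i.+1 by apply/liveS.
split=> //; apply: vedge_transfer => //; [exact: strand_cell fs _ li|exact: strand_cell fs' _ li'|].
(* Link, vertical edge and opposite link all lie in the relation of the left-hand column, so they
   compose; the order depends on the orientation of the edge. *)
rewrite /= negbK; move: vi; rewrite /vedge; case: ifP => _ vi.
  exact: T_trans (strand_back fs' li') (T_trans vi (strand_right fs li)).
exact: T_trans (strand_back fs li) (T_trans vi (strand_right fs' li')).
Qed.

Lemma row_next a k s f : a < 4 -> k \in states c -> k != [::] -> row a k s f ->
  exists f', row (nxt a) (step (k, s)).1 (step (k, s)).2 f'.
Proof.
move=> a4 kc k0 fr; have fs := row_strand fr; have f0 := row_left fr.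
have [f' [fs' f0' up]] := strand_next a4 kc k0 fs f0 (row_state fr).
have rule i A b : live f' i -> (A, b) \in rules c -> lits_sem P (f i) A ->
    lit_sem P (f' i) b.
  move=> li' uc; have [li vi] := up i li'.
  exact: (vertical_rule a4 uc (strand_cell fs li) (strand_cell fs' li') vi).
have fk i : live f' i -> P (State k) (f i).
  by move=> /up[li _]; apply: (strand_state a4 kc fs (row_state fr)).
exists f'; split=> // [|i r rc li'].
  have l0 : live f' 0 by [].
  have [l0' _] := up 0 l0; have tc := tested_registers kc.
  have := row_lt fr tc l0'; rewrite /= lt0n; case: eqP => _ lt0.
    apply: (rule 0 _ (yes _) l0 (rule_state kc (mem_head _ _))) => /=.
    by split; [exact: fk|split=> //; split=> // /lt0].
  apply: (rule 0 _ (yes _) l0 (rule_state kc (mem_second _ _))).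
  by split; [exact: fk|split=> //; split=> //; apply/lt0].
have [li _] := up i li'.
have rr u : u \in reg_rules k r -> u \in rules c := rule_reg kc rc.
have sub := assigned_registers kc rc.
rewrite /=; move: rr sub; rewrite /reg_rules; case: (assigned k r) => [|q|q|q] rr sub /=.
- split=> // ltr; have /(_ ltr) [] : ~ P (Lt r) (f' i).
  by apply: (rule _ _ (no (Lt r)) li' (rr _ (mem_head _ _))); split=> //; apply: fk.
- have qc : q \in registers c by apply: sub; rewrite mem_head.
  have E := row_lt fr qc li; rewrite -E; split=> H.
    case: (classic (P (Lt q) (f i))) => // Hq; have /(_ H) [] : ~ P (Lt r) (f' i).
    by apply: (rule _ _ (no (Lt r)) li' (rr _ (mem_second _ _))); split=> //; apply: fk.
  by apply: (rule _ _ (yes _) li' (rr _ (mem_head _ _))); split=> //; apply: fk.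
- have qc : q \in registers c by apply: sub; rewrite mem_head.
  have E := row_le a4 fr qc li; rewrite ltnS -E; split=> H.
    case: (classic (P (Le q) (f i))) => // Hq; have /(_ H) [] : ~ P (Lt r) (f' i).
    by apply: (rule _ _ (no (Lt r)) li' (rr _ (mem_second _ _))); split=> //; apply: fk.
  by apply: (rule _ _ (yes _) li' (rr _ (mem_head _ _))); split=> //; apply: fk.
- have qc : q \in registers c by apply: sub; rewrite mem_head.
  (* The predecessor rule gives [Le r] off the left edge, so [Lt r] at column [i] is read off one
     column further right. At [End] that column is missing, but both sides are false there. *)
  case: (classic (P End (f' i))) => e'.
    have [_ vi] := up i li'.
    have e : P End (f i) by rewrite (end_up a4 (strand_cell fs li) (strand_cell fs' li') vi).
    have /negP ltq : ~ i < s q by rewrite -(row_lt fr qc li); apply: end_lt.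
    by split=> [/(end_lt rc e')//|]; lia.
  have lj' : live f' i.+1 by apply/liveS.
  have [lj _] := up _ lj'.
  have lfj := strand_left fs lj.
  rewrite -(strand_le (nxt_lt a) rc fs' lj').
  have E := row_lt fr qc lj.
  have -> : (i < (s q).-1) = (i.+1 < s q) by lia.
  rewrite -E; split=> H.
    case: (classic (P (Lt q) (f i.+1))) => // Hq; have /(_ H) [] : ~ P (Le r) (f' i.+1).
    by apply: (rule _ _ (no (Le r)) lj' (rr _ (mem_second _ _))); split=> //; apply: fk.
  by apply: (rule _ _ (yes _) lj' (rr _ (mem_head _ _))); split=> //; apply: fk.
Qed.

Lemma row_input : exists f, row 0 [:: c] (input_store n) f.
Proof.
have [/= [x [ix _]] [H1 _]] := sem_init th.
have [//|ax [lx [kx _]]] := H1 x.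
have [f [f0 fs]] := strand_from (isT : 0 < 4) ax; rewrite -f0 {x f0} in ix ax lx kx.
exists f; split=> //.
have inp i : live f i -> i <= n -> P (Input i) (f i).
  elim: i => [|i IH] // li i_n; have /liveS[li0 _] := li.
  have ii := IH li0 (ltnW i_n).
  have [_ [H2 [H3 _]]] := input_next i_n.
  have ci := strand_cell fs li0; have cj := strand_cell fs li.
  have ij := strand_right fs li; rewrite /= in H2 H3 cj.
  case: (odd i) ci cj ij => ci cj ij.
    by have [|||] // := H3 (f i) (f i.+1).
  by have [|||] // := H2 (f i) (f i.+1).
(* Once [Lt r] fails it fails further right, so marking one column bounds the value. *)
have down i r : r \in registers c -> live f i.+1 -> ~ P (Lt r) (f i) -> ~ P (Lt r) (f i.+1).
  move=> rc li; rewrite -(strand_le (isT : 0 < 4) rc fs li) => lei.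
  have [_ [_ [/= H _]]] := sem_reg th rc.
  by have [|] // := H (f i.+1).
move=> i r rc li; rewrite /input_store; case: eqP => [r0|/eqP r0].
  rewrite {r}r0 in rc *; case: ltnP => i_n.
    have [H _] := input_next i_n.
    by have [|] // := H (f i); split=> //; apply: inp => //; apply: ltnW.
  suff: ~ P (Lt 0) (f i) by [].
  move: i_n li; elim: i => [|i IH] i_n li.
    have [|+ _] // := input_last (x := f 0).
    by split=> //; move: i_n; rewrite leqn0 => /eqP ->.
  move: i_n; rewrite leq_eqVlt => /orP[/eqP i_n|i_n].
    have [|+ _] // := input_last (x := f i.+1).
    by rewrite {1}i_n; split=> //; rewrite -i_n; apply: inp => //; rewrite i_n.
  by apply: down => //; apply: IH => //; have /liveS[] := li.
suff: ~ P (Lt r) (f i) by [].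
elim: i li => [|i IH] li.
  by have [|+ _] // := sem_zero th rc r0 (x := f 0).
by apply: down => //; apply: IH; have /liveS[] := li.
Qed.

Lemma row_halt m : forall a k s f s', a < 4 -> k \in states c -> row a k s f ->
  iter m step (k, s) = ([::], s') -> s' 1 = 0.
Proof.
have halt a s f s' : row a [::] s f -> s = s' -> s' 1 = 0.
  move=> fr <-; have [_ [_ [/= H _]]] := sem_init th.
  have [|lt1 _] := H (f 0).
    by split; [exact: row_state fr|split=> //; exact: row_left fr].
  have := @row_lt _ _ _ _ fr 0 1 isT; case: (s 1) => // q H'.
  by case: lt1; apply/H'.
elim: m => [|m IH] a k s f s' a4 kc fr.
  by move=> [k0 ss]; rewrite k0 in fr; apply: halt fr ss.
(* The program may halt before [m] steps are used up. *)
case: (eqVneq k [::]) => [k0|k0].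
  by rewrite k0 iter_step_halt in fr * => -[ss]; apply: halt fr ss.
rewrite iterSr; have [f' fr'] := row_next a4 kc k0 fr.
move: fr'; rewrite [step _]surjective_pairing; apply: IH; first exact: nxt_lt.
exact: states_next.
Qed.

Lemma halting_output m s' :
  iter m step ([:: c], input_store n) = ([::], s') -> s' 1 = 0.
Proof.
have [f fr] := row_input; apply: row_halt fr => //.
by rewrite inE head_conts orbT.
Qed.

End Soundness.

(** * The finite model of a run *)

Section Completeness.
Variables (c : cmd) (n m width : nat).
Let config (j : nat) : seq cmd * store := iter j step ([:: c], input_store n).

Definition grid : Type := ('I_width.+1 * 'I_m.+1)%type.

Implicit Types x y z : grid.

(** Proper steps lead from even to odd rows and hence never compose, which gives transitivity. *)
Definition near (j j' : nat) : Prop :=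
  j = j' \/ j %% 2 = 0 /\ (j' = j.+1 \/ j = j'.+1).

(** The first relation groups columns [2k] and [2k + 1], the second [2k + 1] and [2k + 2], leaving
    column 0 alone. There the second relation instead makes a clique of rows [2k - 1] and [2k], as
    the upward and downward edges of the left column demand. *)
Definition grid_trans (b : bool) x y : Prop :=
  if b then
    x.1.+1 %/ 2 = y.1.+1 %/ 2 /\
    if x.1 == 0 :> nat then x.2.+1 %/ 2 = y.2.+1 %/ 2 else near x.2 y.2
  else x.1 %/ 2 = y.1 %/ 2 /\ near x.2 y.2.

Definition grid_pred (s : sym) x : Prop :=
  match s with
  | Cell a p => x.2 %% 4 = a /\ x.1 %% 2 = p
  | Left => x.1 = 0 :> nat
  | End => x.1 = width :> nat
  | State k => (config x.2).1 = k
  | Lt r => x.1 < (config x.2).2 r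
  | Le r => x.1 <= (config x.2).2 r
  | Input i => x.1 = i :> nat /\ x.2 = 0 :> nat
  end.

Lemma grid_trans_trans b x y z :
  grid_trans b x y -> grid_trans b y z -> grid_trans b x z.
Proof.
case: x y z => [i j] [i' j'] [i'' j'']; rewrite /grid_trans /near /=.
by case: b; [case: eqP; case: eqP|]; lia.
Qed.

Lemma grid_point i j : i <= width -> j <= m ->
  exists x, x.1 = i :> nat /\ x.2 = j :> nat.
Proof. by move=> iw jm; exists (inord i, inord j); rewrite /= !inordK. Qed.

Lemma grid_bound x : x.1 <= width /\ x.2 <= m.
Proof. by rewrite -ltnS ltn_ord -ltnS ltn_ord. Qed.

Lemma grid_eq x y : x.1 = y.1 :> nat -> x.2 = y.2 :> nat -> x = y.
Proof. by case: x y => [i j] [i' j'] /= /val_inj -> /val_inj ->. Qed.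

(** Equal row classes modulo 4 exclude a vertical step, and the parities single out the left member
    of a column pair. *)
Lemma grid_right a p x y : grid_pred (Cell a p) x -> grid_trans p x y ->
  grid_pred (Cell a (~~ p)) y -> y.1 = x.1.+1 :> nat /\ y.2 = x.2 :> nat.
Proof.
rewrite /grid_trans /near /=; case: p => /=; last lia.
by case: eqP; lia.
Qed.

Lemma grid_above a p x y : grid_pred (Cell a p) x -> grid_pred (Cell (nxt a) p) y ->
  (if odd a then grid_trans p y x else grid_trans p x y) ->
  y.1 = x.1 :> nat /\ y.2 = x.2.+1 :> nat.
Proof.
rewrite /grid_trans /near /nxt /=.
by case: ifP => oa; case: p => /=; [case: eqP| |case: eqP|]; lia.
Qed.

Lemma grid_rule x y u : u \in rules c ->
  y.1 = x.1 :> nat -> y.2 = x.2.+1 :> nat ->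
  lits_sem grid_pred x u.1 -> lit_sem grid_pred y u.2.
Proof.
rewrite /rules 2!mem_cat => uc E1 E2.
have cE : config y.2 = step (config x.2) by rewrite E2 /config iterS.
have [xb yb] : x.2 < m /\ x.1 <= width.
  by have [] := grid_bound y; have [] := grid_bound x; lia.
case/or3P: uc => [|/flatten_mapP[k kc]|/flatten_mapP[k kc] /flatten_mapP[r rc]].
- by rewrite !inE => /orP[] /eqP -> /=; rewrite /lit_sem /= E1; tauto.
- rewrite !inE => /orP[] /eqP -> /=; rewrite /lit_sem /= cE /= => -[<- [-> [+ _]]].
    by case: (_.2 _).
  by case: (_.2 _).
have lt_q : grid_pred (State k) x -> (config y.2).2 r = eval (assigned k r) (config x.2).2.
  by move=> /= <-; rewrite cE.
rewrite /reg_rules; case: (assigned k r) lt_q => [|q|q|q] lt_q; rewrite !inE => H.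
- by move/eqP: H => -> [/lt_q] /=; rewrite /lit_sem /= => ->.
- by case/orP: H => /eqP -> [/lt_q] /=; rewrite /lit_sem /= => -> [] +; rewrite E1.
- by case/orP: H => /eqP -> [/lt_q] /=; rewrite /lit_sem /= => -> [] +; rewrite E1; lia.
- by case/orP: H => /eqP -> [/lt_q] /=; rewrite /lit_sem /= => -> [] + [] +; rewrite E1; lia.
Qed.

Variable final : store.
Hypothesis halts : config m = ([::], final).
Hypothesis final1 : final 1 = 0.
Hypothesis widthP : forall j r, j <= m -> r \in registers c -> (config j).2 r <= width.

(** The row [m] need not be the first halted one, but a halted configuration no longer changes. *)
Lemma halted j : j <= m -> (config j).1 = [::] -> (config j).2 1 = 0.
Proof.
move=> jm cj; suff : config m = config j by rewrite halts => <-.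
rewrite -(subnK jm) /config iterD -/(config j).
by move: cj; case: (config j) => k s /= ->; rewrite iter_step_halt.
Qed.

Lemma grid_theory : theory_sem grid_pred grid_trans c.
Proof.
split.
- have [x [x1 x2]] := grid_point (leq0n width) (leq0n m).
  split=> /=; first by exists x.
  split; first by move=> y [[y1 y2] _]; rewrite /lit_sem /= y1 y2.
  split=> // y [ky [ly _]]; split=> //; rewrite /lit_sem /=.
  have [_ yb] := grid_bound y; rewrite /lit_sem /= in ky ly.
  by rewrite (halted yb ky).
- move=> r _ /negPf r0 x [[x1 x2] _]; split=> //.
  by rewrite /lit_sem /= x1 x2 /= /input_store r0.
- move=> r rc; split; first by move=> x [x1 _]; split=> //; rewrite /lit_sem /= in x1 *; lia.
  split.
    move=> x [x1 _]; split=> //; rewrite /lit_sem /= in x1 *.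
    have [_ xb] := grid_bound x.
    by have := widthP xb rc; lia.
  split=> // x [x1 _]; split=> //; rewrite /lit_sem /= in x1 *; lia.
- move=> a a4; rewrite /left_clauses; case: ifP => // oa; split=> // x /= [].
  rewrite /lit_sem /= /nxt => x1 [[x2 _] [x0 _]].
  have [_ xb] := grid_bound x.
  have [|y [y1 y2]] := @grid_point 0 x.2.-1 isT; first lia.
  by exists y; rewrite /lit_sem /grid_trans /near /= x1 y1 y2 /=; lia.
- move=> a k a4 kc; case: k kc => // d l _; split=> // x /= [].
  rewrite /lit_sem /= /nxt => x1 [[x2 _] [kx _]].
  have [_ xb] := grid_bound x.
  (* The top row is halted, so a nonempty continuation leaves room above. *)
  have xm : x.2 < m.
    rewrite ltn_neqAle xb andbT; apply/eqP => xm.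
    by move: kx; rewrite xm halts.
  have [y [y1 y2]] := grid_point (leq0n width) xm.
  exists y; rewrite /grid_trans /near x1 y1 y2 /=.
  by case oa: (odd a); lia.
- move=> a p a4; have nlt : nxt a < 4 := nxt_lt a.
  split.
    move=> x /= []; rewrite /lit_sem /= => -[x2 x1] [xe _].
    have [xb1 xb2] := grid_bound x.
    have [|y [y1 y2]] := @grid_point x.1.+1 x.2 _ xb2; first lia.
    exists y; rewrite /grid_trans /near y1 y2 /=.
    by case: p x1 => /= x1; [case: eqP|]; lia.
  split.
    move=> x /= []; rewrite /lit_sem /= => -[x2 x1] [xl _].
    have [xb1 xb2] := grid_bound x.
    have [|y [y1 y2]] := @grid_point x.1.-1 x.2 _ xb2; first lia.
    exists y; rewrite /grid_trans /near y1 y2 /=.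
    by case: p x1 => /= x1; [case: eqP|]; lia.
  split.
    move=> x y /= [[x2 x1] _] /= [T1 T2] [[y2 y1] _].
    by apply: grid_eq; move: T2; rewrite /near; case: p x1 y1 => /=; lia.
  split.
    move=> x y /= [[x2 x1] _] /= [T1 T2] [[y2 y1] _].
    by apply: grid_eq; move: T2; rewrite /near; case: eqP => x0; case: p x1 y1 => /=; lia.
  split=> // x y /= [[x2 x1] _] T1 [[y2 y1] _]; move: x2 y2 T1.
  rewrite /grid_trans /near /src /dst /nxt.
  by case: ifP => oa; case: p x1 y1 => /= x1 y1; case: eqP; lia.
- move=> a p r a4 rc; split.
    move=> x y /= [ax [ltx _]] xy [ay _]; split=> //.
    by have [y1 y2] := grid_right ax xy ay; move: ltx; rewrite /lit_sem /= y1 y2.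
  split=> //; move=> x y /= [ax [ltx _]] xy [ay _]; split=> //.
  by have [y1 y2] := grid_right ax xy ay; move: ltx; rewrite /lit_sem /= y1 y2.
- move=> a p k a4 kc x y /= [ax [kx _]] xy [ay _]; split=> //.
  by have [y1 y2] := grid_right ax xy ay; move: kx; rewrite /lit_sem /= y2.
- move=> a p u a4 uc; rewrite /rule_clause; case: ifP => oa /= x y.
    move=> [ax [nb _]] xy [ay yA]; exfalso.
    have [|x1 x2] := @grid_above a p y x ay ax; first by rewrite oa.
    have := grid_rule uc x1 x2 yA; move: nb.
    by case: (u.2) => t [].
  move=> [ax xA] xy [ay _]; split=> //.
  have [|y1 y2] := @grid_above a p x y ax ay; first by rewrite oa.
  exact: grid_rule uc y1 y2 xA.
Qed.

Lemma grid_input_last :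
  clause_sem grid_pred grid_trans (Local [:: yes (Input n)] [:: no (Lt 0)]).
Proof.
move=> x [[x1 x2] _]; split=> //; rewrite /lit_sem /= x1 x2 /= /input_store /=.
by rewrite ltnn.
Qed.

Lemma grid_input_next i : i < n -> all_sem grid_pred grid_trans (input_step i).
Proof.
move=> i_n; split; first by move=> x [[x1 x2] _]; split=> //; rewrite /lit_sem /= x1 x2.
have H p : clause_sem grid_pred grid_trans (Forall [:: yes (Input i); yes (Cell 0 p)] p
    [:: yes (Cell 0 (~~ p))] [:: yes (Input i.+1)]).
  move=> x y [[x1 x2] [ax _]] xy [ay _]; split=> //.
  by have [y1 y2] := grid_right ax xy ay; rewrite /lit_sem /= y1 y2 x1 x2.
split; first exact: H.
by split=> //; exact: H.
Qed.

End Completeness.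

(** * Undecidability *)

(** One conjunct depends on the program alone and the other on the input alone, as the diagonal
    argument requires. *)
Definition run_form (c : cmd) (n : nat) : formula :=
  And (conj_form (theory c)) (input_form n).

Lemma holds_run (M : structure) (v : nat -> M) c n :
  holds v (run_form c n) <->
  [/\ theory_sem (@sym_pred M) (@trans_rel M) c,
      clause_sem (@sym_pred M) (@trans_rel M)
        (Local [:: yes (Input n)] [:: no (Lt 0)])
    & forall i, i < n -> all_sem (@sym_pred M) (@trans_rel M) (input_step i)].
Proof.
have -> : holds v (run_form c n) <->
  holds v (conj_form (theory c)) /\ holds v (input_form n) by [].
split=> [[/holds_conj/all_sem_theory th /holds_input[]]|[th il inx]] //.
by split; [apply/holds_conj/all_sem_theory|apply/holds_input].
Qed.

Lemma run_form_unsat c n m s :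
  iter m step ([:: c], input_store n) = ([::], s) -> s 1 != 0 ->
  ~ satisfiable (run_form c n).
Proof.
move=> halts /eqP s1 [M [v [[T0 T1] /holds_run[th il inx]]]]; apply: s1.
apply: halting_output th il inx m s halts => -[]; [exact: T1|exact: T0].
Qed.

Lemma In_mem (X : eqType) (x : X) (xs : seq X) : x \in xs -> List.In x xs.
Proof. by elim: xs => //= y xs IH; rewrite inE => /orP[/eqP->|/IH]; [left|right]. Qed.

Lemma run_form_finsat c n m s :
  iter m step ([:: c], input_store n) = ([::], s) -> s 1 = 0 ->
  finitely_satisfiable (run_form c n).
Proof.
move=> halts s1; pose config j := iter j step ([:: c], input_store n).
(* The width is the largest register value in the run. *)
have [width widthP] : exists w, forall j r, j <= m -> r \in registers c ->
    (config j).2 r <= w.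
  exists (\max_(j < m.+1) \max_(r <- registers c) (config j).2 r) => j r jm rc.
  apply: leq_trans (leq_bigmax (Ordinal (jm : j < m.+1))).
  exact: leq_bigmax_seq.
pose P := @grid_pred c n m width; pose T := @grid_trans m width.
pose M := @Structure (grid m width) (inhabits (ord0, ord0)) (fun p xs =>
  match xs with
  | [:: x] => exists s, sym_code s = p /\ P s x
  | [:: x; y] => exists b : bool, p = b /\ T b x y
  | _ => False
  end).
have PE : @sym_pred M = P.
  apply: functional_extensionality => t; apply: functional_extensionality => x.
  apply: propositional_extensionality; split=> [[t' [/sym_code_inj ->]] //|Px].
  by exists t.
have TE : @trans_rel M = T.
  apply: functional_extensionality => b; apply: functional_extensionality => x.
  apply: functional_extensionality => y; apply: propositional_extensionality.
  by split=> [[b' [bb]]|Txy]; [case: b b' bb => -[]|exists b].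
exists M, (fun=> (ord0, ord0)); split.
- by exists (enum {: 'I_width.+1 * 'I_m.+1}) => x; apply: In_mem; rewrite mem_enum.
- have tr b : Relation_Definitions.transitive M (@trans_rel M b).
    by rewrite TE => x y z xy yz; apply: grid_trans_trans xy yz.
  by split; [apply: (tr false)|apply: (tr true)].
- apply/holds_run; rewrite PE TE; split.
  + exact: grid_theory halts s1 widthP.
  + exact: grid_input_last.
  + by move=> i; apply: grid_input_next.
Qed.

Lemma undecidable (Q : formula -> Prop) :
  (forall phi, finitely_satisfiable phi -> Q phi) ->
  (forall phi, Q phi -> satisfiable phi) -> ~ decidable_problem FL2 Q.
Proof.
move=> finQ Qsat [f fP].
(* The tag 3 is that of [And]: the first conjunct is given by its code, the second states that this
   code is the input. *)
pose F (t : 1.-tuple nat) :=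
  pair_code 3 (pair_code (thead t) (code (input_form (thead t)))).
have [g gP] : computable F.
  have id1 : computable (fun t : 1.-tuple nat => thead t) := computable_proj ord0.
  apply: computable_pair; first exact: computable_const.
  exact: computable_pair id1 (computable_input_form id1).
pose c := compile (Comp f (fun _ : 'I_1 => g)) [:: 0] 1 2.
(* At this [n], the value of [F] is by conversion the code of [run_form c n]: the program queries
   the decider about its own run. *)
pose n := code (conj_form (theory c)).
have [|b [fb Qb]] := fP (run_form c n).
  apply: FL2_sentenceP; apply: FL2_sentence_and; first exact: FL2_sentence_conj.
  exact: FL2_sentence_input.
have fgb : computes (Comp f (fun _ : 'I_1 => g)) [tuple n] b.
  exists [tuple code (run_form c n)]; split=> // i.
  by rewrite [i]ord1; apply: (gP [tuple n]).
have [||| s [run_s s1 _]] :=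
  compile_correct fgb (a := [:: 0]) (o := 1) (b := 2) (s := input_store n).
- by [].
- by move=> r; rewrite inE => /eqP ->.
- by [].
have [m halts] := run_s [::].
(* The answer is coerced to the output 1 or 0: a positive one makes the sentence unsatisfiable, a
   negative one finitely satisfiable. *)
case: b s1 {fb fgb} Qb => s1 Qb.
  by apply: (run_form_unsat halts); [rewrite s1|apply/Qsat/Qb].
by have /finQ/Qb := run_form_finsat halts s1.
Qed.

Theorem theorem15 :
  ~ decidable_problem FL2 satisfiable /\
  ~ decidable_problem FL2 finitely_satisfiable.
Proof.
have fin_sat phi : finitely_satisfiable phi -> satisfiable phi.
  by move=> [M [v [_ Mtr Mphi]]]; exists M, v.
by split; apply: undecidable.
Qed.
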